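(* In the setting of the context, suppose that $$-\frac{\partial^2 q(t,y,u)}{\partial u^2}<\eta e^{R(T-t)}\lambda(t,y)\,\mathbb E\bigl[Z^2e^{\eta(1-u)Ze^{R(T-t)}}\bigr]\qquad\forall(t,y,u)\in[0,T]\times\mathbb R\times(0,1).$$ Then there exists a unique measurable function $u^*(t,y)$, $(t,y)\in[0,T]\times\mathbb R$, which solves $\sup_{u\in[0,1]}\Psi^u(t,y)$ for every $(t,y)$. Moreover it is given by $$u^*(t,y)=\begin{cases}0&(t,y)\in A_0\\ \hat u(t,y)&(t,y)\in\hat A\\ 1&(t,y)\in A_1\end{cases}$$ where $$A_0=\Bigl\{(t,y)\in[0,T]\times\mathbb R:\ \lambda(t,y)\mathbb E[Ze^{\eta Ze^{R(T-t)}}]\le\tfrac{\partial q(t,y,0)}{\partial u}\Bigr\},$$ $$\hat A=\Bigl\{(t,y)\in[0,T]\times\mathbb R:\ \lambda(t,y)\mathbb E[Ze^{\eta Ze^{R(T-t)}}]>\tfrac{\partial q(t,y,0)}{\partial u},\ \tfrac{\partial q(t,y,1)}{\partial u}>\mathbb E[Z]\lambda(t,y)\Bigr\},$$ $$A_1=\Bigl\{(t,y)\in[0,T]\times\mathbb R:\ \tfrac{\partial q(t,y,1)}{\partial u}\le\mathbb E[Z]\lambda(t,y)\Bigr\},$$ and $\hat u(t,y)$ is the unique solution of $$\frac{\partial q(t,y,u)}{\partial u}=\lambda(t,y)\int_0^Dze^{\eta(1-u)ze^{R(T-t)}}\,dF_Z(z).$$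
   Context: Fix $T>0$, $R>0$, $\eta>0$, $D\in(0,+\infty]$. $\lambda:[0,T]\times\mathbb R\to(0,+\infty)$ and $c:[0,T]\times\mathbb R\to(0,+\infty)$ are measurable. $Z$ is a strictly positive random variable with distribution function $F_Z$, $F_Z(z)=1$ for $z\ge D$, and $\mathbb E[e^{\eta Ze^{RT}}]$, $\mathbb E[Ze^{\eta Ze^{RT}}]$, $\mathbb E[Z^2e^{\eta Ze^{RT}}]$ are finite. The reinsurance premium $q:[0,T]\times\mathbb R\times[0,1]\to[0,+\infty)$ is continuous in $(t,y,u)$, has continuous derivatives $\partial q/\partial u$, $\partial^2q/\partial u^2$ in $u\in[0,1]$ (at $u=0$ and $u=1$, right and left derivatives respectively), and satisfies $q(t,y,0)=0$, $\partial q(t,y,u)/\partial u\ge0$ and $q(t,y,1)>c(t,y)$ for all $(t,y,u)$. $\Psi^u(t,y)=-\eta e^{R(T-t)}q(t,y,u)+\lambda(t,y)\int_0^D[1-e^{\eta(1-u)ze^{R(T-t)}}]\,dF_Z(z)$. *)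

(* Defs.v *)
From HB Require Import structures.
From mathcomp Require Import all_boot all_order all_algebra.
From mathcomp Require Import all_classical all_reals all_analysis.

Set Implicit Arguments.
Unset Strict Implicit.
Unset Printing Implicit Defensive.

Import Order.TTheory GRing.Theory Num.Theory.
Import numFieldNormedType.Exports.

Local Open Scope classical_set_scope.
Local Open Scope ring_scope.

(* Derivative relative to a set [A]: the increment ranges over the points of
   [A] only, so that on a closed interval this is the usual derivative in the
   interior and the right (left) derivative at the left (right) endpoint. *)
Section derivative_on.
Context {R : realType}.
Implicit Types (A : set R) (f : R -> R) (x : R).

Definition derivable_on A f x : Prop :=
  cvg ((fun y => (f y - f x) / (y - x)) @ within A x^').

Definition derive_on A f x : R :=
  lim ((fun y => (f y - f x) / (y - x)) @ within A x^').

End derivative_on.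

Section distribution_function.
Context {d} {Omega : measurableType d} {R : realType}.
Context {P : probability Omega R} (Z : {RV P >-> R}).

Definition distr_fun (z : R) : R := fine (cdf Z z).

Let distr_fun_nd : nondecreasing distr_fun.
Proof. by move=> a b ab; rewrite fine_le ?fin_num_measure// cdf_nondecreasing. Qed.

Let distr_fun_rc : right_continuous distr_fun.
Proof.
move=> a; apply: fine_cvg.
by rewrite fineK ?fin_num_measure//; exact: cdf_right_continuous.
Qed.

HB.instance Definition _ :=
  isCumulative.Build R _ R distr_fun distr_fun_nd distr_fun_rc.

End distribution_function.

Section reinsurance.
Context {d} {Omega : measurableType d} {R : realType}.
Context {P : probability Omega R} (Z : {RV P >-> R}).
(* [r] is the interest rate, written R on paper. *)
Variables (T r eta : R) (D : \bar R).
Variables (lambda : R -> R -> R) (q : R -> R -> R -> R).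

Definition time_space : set (R * R) := `[0, T] `*` [set: R].

Definition dq (t y u : R) : R := derive_on `[0, 1] (q t y) u.

Definition d2q (t y u : R) : R := derive_on `[0, 1] (dq t y) u.

(* The interval of integration from 0 to [D], where [D] may be infinite; the
   endpoint 0 is immaterial because [Z] is almost surely positive. *)
Definition claim_range : set R := [set z | 0 < z /\ (z%:E <= D)%E].

Local Open Scope ereal_scope.

(* The integrals and expectations below are extended real numbers. *)
Definition Psi (t y u : R) : \bar R :=
  (- eta * expR (r * (T - t)) * q t y u)%:E +
  (lambda t y)%:E *
    \int[lebesgue_stieltjes_measure (distr_fun Z)]_(z in claim_range)
      (1 - expR (eta * (1 - u) * z * expR (r * (T - t))))%:E.

Definition solves_sup (t y v : R) : Prop :=
  v \in `[0%R, 1%R] /\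
  Psi t y v = ereal_sup [set Psi t y u | u in `[0%R, 1%R]].

Definition solves_foc (t y u : R) : Prop :=
  u \in `[0%R, 1%R] /\
  (dq t y u)%:E =
    (lambda t y)%:E *
      \int[lebesgue_stieltjes_measure (distr_fun Z)]_(z in claim_range)
        (z * expR (eta * (1 - u) * z * expR (r * (T - t))))%:E.

Definition A0 : set (R * R) := [set p | time_space p /\
  (lambda p.1 p.2)%:E *
    'E_P[(fun w => Z w * expR (eta * Z w * expR (r * (T - p.1))))%R]
  <= (dq p.1 p.2 0)%:E].

Definition Ahat : set (R * R) := [set p | [/\ time_space p,
  (dq p.1 p.2 0)%:E <
    (lambda p.1 p.2)%:E *
      'E_P[(fun w => Z w * expR (eta * Z w * expR (r * (T - p.1))))%R] &
  'E_P[Z] * (lambda p.1 p.2)%:E < (dq p.1 p.2 1)%:E]].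

Definition A1 : set (R * R) := [set p | time_space p /\
  (dq p.1 p.2 1)%:E <= 'E_P[Z] * (lambda p.1 p.2)%:E].

End reinsurance.

(* Main.v *)
(* Write a = eta e^(r(T-t)) and M_k(s) = E[Z^k e^(sZ)]. Then Psi^u is
   h(u) = - a q(u) + lambda (1 - M_0(a (1 - u))), with derivative a g(u), where
   g(u) = lambda M_1(a (1 - u)) - q'(u). The hypothesis on q'' says g' < 0 inside
   the unit interval, so h is strictly concave: its maximizer is unique, and the
   signs of g(0) and g(1) decide between 0, 1 and the zero of g.
   The only delicate endpoint is u = 0 at t = 0, where a (1 - u) is the largest
   exponent with finite moments: there M_0 and M_1 are continuous because
   convexity of exp makes M_k Lipschitz with constant M_(k+1).
   Measurability of the maximizer u* follows from u*(t,y) > b iff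
   Psi^(b + 1/n) > Psi^b for some n with b + 1/n <= 1, so only the measurability
   of Psi^u in (t,y) for fixed u is needed, and no measurable selection. *)

Require Import Defs.
From HB Require Import structures.
From mathcomp Require Import all_boot all_order all_algebra.
From mathcomp Require Import all_classical all_reals all_analysis.
From mathcomp Require Import measurable_realfun ring lra.

Set Implicit Arguments.
Unset Strict Implicit.
Unset Printing Implicit Defensive.

Import Order.TTheory GRing.Theory Num.Theory.
Import numFieldNormedType.Exports.

Local Open Scope classical_set_scope.
Local Open Scope ring_scope.

(** * Exponential moments: domination, Lipschitz bound, derivative *)

Section exponential_moment.
Context {R : realType} (mu : {measure set (measurableTypeR R) -> \bar R}).
Variables (B : set R) (s0 : R).
Hypothesis mB : @measurable _ (measurableTypeR R) B.
Hypothesis B_gt0 : forall z, B z -> 0 < z.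

(** Being real-valued, this takes the value 0 where the integral is infinite; the lemmas below
    therefore assume integrability at a top exponent [s0]. *)
Definition expmoment (k : nat) (s : R) : R :=
  \int[mu]_(z in B) (z ^+ k * expR (s * z)).

Lemma measurable_powexp (A : set R) k s :
  measurable_fun A (fun z : R => z ^+ k * expR (s * z)).
Proof.
apply: measurable_funM; first exact: measurable_funX.
by apply: measurableT_comp => //; exact: measurable_funM.
Qed.

(** On [B] every [z] is positive, so the integrand grows with the exponent and the one at [s0]
    dominates. *)
Lemma integrable_powexp k s : s <= s0 ->
  mu.-integrable B (fun z => (z ^+ k * expR (s0 * z))%:E) ->
  mu.-integrable B (fun z => (z ^+ k * expR (s * z))%:E).
Proof.
move=> ss0; apply: le_integrable => //.
  by apply/measurable_EFinP; exact: measurable_powexp.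
move=> z /B_gt0 z0; rewrite lee_fin.
rewrite !ger0_norm ?mulr_ge0 ?exprn_ge0 ?expR_ge0 ?(ltW z0)//.
by rewrite ler_wpM2l ?exprn_ge0 ?(ltW z0)// ler_expR ler_wpM2r ?(ltW z0).
Qed.

Lemma expmomentE k s : s <= s0 ->
  mu.-integrable B (fun z => (z ^+ k * expR (s0 * z))%:E) ->
  (\int[mu]_(z in B) (z ^+ k * expR (s * z))%:E)%E = (expmoment k s)%:E.
Proof.
move=> ss0 int0; rewrite /expmoment /Rintegral fineK//.
by apply: integrable_fin_num => //; exact: integrable_powexp ss0 int0.
Qed.

Lemma le_expmoment k s t : s <= t -> t <= s0 ->
  mu.-integrable B (fun z => (z ^+ k * expR (s0 * z))%:E) ->
  expmoment k s <= expmoment k t.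
Proof.
move=> st ts0 int0; apply: le_Rintegral => //.
- exact: integrable_powexp (le_trans st ts0) int0.
- exact: integrable_powexp ts0 int0.
- move=> z /B_gt0/ltW z0.
  by rewrite ler_wpM2l ?exprn_ge0// ler_expR ler_wpM2r.
Qed.

Lemma powexp_lipschitz k (z s t : R) : 0 <= z -> s <= t -> t <= s0 ->
  z ^+ k * expR (t * z) <=
    z ^+ k * expR (s * z) + (t - s) * (z ^+ k.+1 * expR (s0 * z)).
Proof.
move=> z0 st ts0.
(* [expR (s * z) >= expR (t * z) * (1 + (s * z - t * z))] by convexity *)
have h1 : expR (t * z) * (1 + (s * z - t * z)) <= expR (s * z).
  rewrite -[in leRHS](subrK (t * z) (s * z)) [in leRHS]addrC expRD.
  by rewrite ler_wpM2l ?expR_ge0// expR_ge1Dx.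
have h2 : expR (t * z) <= expR (s0 * z) by rewrite ler_expR ler_wpM2r.
have h3 : (t - s) * z * expR (t * z) <= (t - s) * z * expR (s0 * z).
  by rewrite ler_wpM2l// mulr_ge0// subr_ge0.
have -> : (t - s) * (z ^+ k.+1 * expR (s0 * z)) =
    z ^+ k * ((t - s) * z * expR (s0 * z)) by rewrite exprS; ring.
rewrite -mulrDr ler_wpM2l ?exprn_ge0//.
lra.
Qed.

Lemma expmoment_lipschitz k s t : s <= s0 -> t <= s0 ->
  mu.-integrable B (fun z => (z ^+ k * expR (s0 * z))%:E) ->
  mu.-integrable B (fun z => (z ^+ k.+1 * expR (s0 * z))%:E) ->
  `|expmoment k t - expmoment k s| <= expmoment k.+1 s0 * `|t - s|.
Proof.
move=> + + int0 int1; wlog st : s t / s <= t => [wlg ss0 ts0|].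
  have [st|/ltW ts] := leP s t; first exact: wlg.
  by rewrite distrC (distrC t); exact: wlg.
move=> ss0 ts0.
rewrite !ger0_norm ?subr_ge0 ?le_expmoment//.
have ints := integrable_powexp ss0 int0.
have intt := integrable_powexp ts0 int0.
have intZ : mu.-integrable B
    (EFin \o fun z => (t - s) * (z ^+ k.+1 * expR (s0 * z))).
  exact: (integrableZl mB (t - s) int1).
rewrite lerBlDl mulrC /expmoment -RintegralZl// -RintegralD//.
apply: le_Rintegral => //.
  exact: (integrableD mB ints intZ).
by move=> z /B_gt0/ltW z0; exact: powexp_lipschitz.
Qed.

Lemma is_derive_powexp k (z x : R) :
  is_derive x (1 : R) (fun s => z ^+ k * expR (s * z))
    (z ^+ k.+1 * expR (x * z)).
Proof.
have h : is_derive x (1 : R) (fun s => s * z) z.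
  have -> : (fun s => s * z) = z \*: (id : R -> R).
    by apply/funext => s; rewrite /= mulrC.
  by apply: is_derive_eq; rewrite [LHS]mulr1.
have he : is_derive x (1 : R) (expR \o (fun s => s * z)) (expR (x * z) * z).
  exact: is_derive1_comp.
have := is_deriveZ (z ^+ k) he.
by rewrite [_ *: _]mulrA mulrAC -exprSr.
Qed.

(** Differentiation under the integral on []s - 1, s0[]: the strict inequality makes [s] interior,
    the left end is arbitrary, and the integrand of order [k + 1] at [s0] dominates all the
    derivatives. *)
Lemma is_derive_expmoment k s : s < s0 ->
  mu.-integrable B (fun z => (z ^+ k * expR (s0 * z))%:E) ->
  mu.-integrable B (fun z => (z ^+ k.+1 * expR (s0 * z))%:E) ->
  is_derive s (1 : R) (expmoment k) (expmoment k.+1 s).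
Proof.
move=> ss0 int0 int1.
pose f (x z : R) : R := z ^+ k * expR (x * z).
pose G (z : R) : R := `|z ^+ k.+1 * expR (s0 * z)|.
have d1f x z : partial1of2 f x z = z ^+ k.+1 * expR (x * z).
  rewrite /partial1of2 derive1E.
  by have /@derive_val := is_derive_powexp k z x.
have Is : `]s - 1, s0[%classic s by rewrite /= in_itv/= ss0 andbT ltrBlDr ltrDl.
have intf x : `]s - 1, s0[%classic x -> mu.-integrable B (EFin \o f x).
  by rewrite /= in_itv/= => /andP[_ /ltW xs0]; exact: integrable_powexp xs0 int0.
have derf x z : `]s - 1, s0[%classic x -> B z -> derivable (f^~ z) x 1.
  by move=> _ _; have [] := is_derive_powexp k z x.
have intG : mu.-integrable B (EFin \o G) by exact: integrable_norm.
have GE x z : `]s - 1, s0[%classic x -> B z -> `|partial1of2 f x z| <= G z.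
  rewrite /= in_itv/= => /andP[_ /ltW xs0] /B_gt0/ltW z0.
  rewrite d1f /G !ger0_norm ?mulr_ge0 ?exprn_ge0 ?expR_ge0//.
  by rewrite ler_wpM2l ?exprn_ge0// ler_expR ler_wpM2r.
have G0 z : 0 <= G z by rewrite normr_ge0.
apply: DeriveDef.
  exact: (derivable_under_integral mB Is intf derf G0 intG GE).
rewrite -derive1E (differentiation_under_integral mB Is intf derf G0 intG GE).
by apply: eq_Rintegral => z _; rewrite d1f.
Qed.

End exponential_moment.

(** * Borel measurability in the plane *)

Section planar_measurability.
Context {R : realType}.

Lemma open_measurable_prod (U : set (R * R)) : open U -> measurable U.
Proof.
move=> oU.
pose box (i : rat * rat * nat) : set (R * R) :=
  ball (ratr i.1.1 : R) i.2.+1%:R^-1 `*` ball (ratr i.1.2 : R) i.2.+1%:R^-1.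
(* Countably many boxes with rational centres and radii [1/(n+1)] suffice; those not contained in
   [U] are replaced by the empty set, so that the index runs over a whole countable type. *)
have -> : U = \bigcup_(i in [set: rat * rat * nat])
    (if `[< box i `<=` U >] then box i else set0).
  apply/seteqP; split => [[x y] Uxy|[x y] [i _]]; last first.
    by case: ifPn => // /asboolP; exact.
  have /nbhs_ballP[e /= e0 eU] : nbhs (x, y) U by exact: open_nbhs_nbhs.
  (* A box of radius below [e / 2] that contains [(x, y)] lies in the [e]-ball around it. *)
  have [n ne] : exists n : nat, n.+1%:R^-1 < e / 2.
    have /cvgr_lt/(_ (e / 2)) := @cvg_harmonic R.
    by rewrite divr_gt0// => /(_ isT) [n _ /(_ n (leqnn _))]; exists n.
  have n0 : 0 < n.+1%:R^-1 :> R by rewrite invr_gt0.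
  have ratball (a : R) : exists p : rat, ball (ratr p : R) n.+1%:R^-1 a.
    have /rat_in_itvoo[p] : a - n.+1%:R^-1 < a + n.+1%:R^-1.
      by rewrite ltrD2l gtrN.
    rewrite in_itv/= => /andP[ap pa]; exists p.
    by rewrite /ball/= distrC ltr_distlC ap pa.
  have [p px] := ratball x; have [p' py] := ratball y.
  exists (p, p', n) => //; rewrite asboolT; first by split.
  move=> [a b] [/= pa pb]; apply: eU; split => /=.
    rewrite [e]splitr; apply: (@ball_triangle _ _ (ratr p : R)).
      exact/ball_sym/(le_ball (ltW ne)).
    exact: (le_ball (ltW ne)).
  rewrite [e]splitr; apply: (@ball_triangle _ _ (ratr p' : R)).
    exact/ball_sym/(le_ball (ltW ne)).
  exact: (le_ball (ltW ne)).
apply: countable_bigcupT_measurable => [|i]; first exact: countableP.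
by case: ifPn => // _; apply: measurableX; exact: measurable_ball.
Qed.

(** Open intervals generate the Borel sets, and the preimage of one is the trace on [A] of an open
    set of the plane. *)
Lemma continuous_within_measurable_prod (A : set (R * R)) (f : R * R -> R) :
  measurable A -> {within A, continuous f} -> measurable_fun A f.
Proof.
move=> mA /continuousP cf.
apply: (measurability _ (RGenOpens.measurableE R)).
move=> _ [_ [a [b ->] <-]].
have /open_subspaceP[V oV VA] := cf _ (@interval_open _ (BRight a) (BLeft b) isT isT).
by rewrite setIC -VA; apply: measurableI => //; exact: open_measurable_prod.
Qed.

End planar_measurability.

(** * Continuity and differentiability relative to a subset *)

Lemma within_continuous_comp (X Y Z : topologicalType) (A : set X) (B : set Y)
    (f : Y -> Z) (g : X -> Y) :
  {within B, continuous f} -> continuous g -> (forall x, A x -> B (g x)) ->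
  {within A, continuous (f \o g)}.
Proof.
move=> /subspace_continuousP cf cg AB; apply/subspace_continuousP => x Ax.
apply: cvg_trans (cf _ (AB _ Ax)) => V /=.
rewrite !nbhs_simpl /within /= => /cg; rewrite nbhs_simpl/=.
by apply: filterS => z /= Bz Az; apply: Bz; exact: AB.
Qed.

(** Near an interior point the constraint of lying in [[a, b]] holds automatically, so the relative
    and the ordinary punctured neighbourhoods of [x] coincide. *)
Lemma derivable_on_interior {R : realType} (f : R -> R) (a b x : R) :
  x \in `]a, b[ -> derivable_on `[a, b] f x ->
  is_derive x (1 : R) f (derive_on `[a, b] f x).
Proof.
move=> xab.
have itvx : within `[a, b] x^' = x^' :> set_system R.
  apply/seteqP; split => U; rewrite /within /dnbhs/=.
    have : \forall y \near x, y \in `]a, b[ by exact: near_in_itvoo.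
    by apply: filterS2 => y /subset_itv_oo_cc yab h yx; exact: h.
  by apply: filterS => y h _.
rewrite /derivable_on /derive_on itvx => dfx.
set l := lim _.
have {dfx} : (f y - f x) / (y - x) @[y --> x^'] --> l by [].
move=> dfx.
suff h : h^-1 *: (f (h *: 1 + x) - f x) @[h --> 0^'] --> l.
  apply: DeriveDef; first by apply/cvg_ex; exists l.
  exact/cvg_lim.
(* Sequences carry out the substitution [y = h + x] between the two forms of the difference
   quotient. *)
apply/cvgr_dnbhsP => t [t_neq0 t_cvg0].
move/cvgr_dnbhsP : dfx => /(_ (fun n => t n + x)) dfx.
have -> : (fun n => (t n)^-1 *: (f (t n *: 1 + x) - f x)) =
    (fun n => (f (t n + x) - f x) / (t n + x - x)).
  by apply/funext => n; rewrite addrK mulrC [t n *: 1]mulr1.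
apply: dfx; split => [n|]; first by rewrite -subr_eq0 addrK.
rewrite -[X in _ --> X]add0r; apply: cvgD => //; exact: cvg_cst.
Qed.

(** * Unimodal functions on the unit interval *)

Section unimodal.
Context {R : realType}.

(* The peak [m] is [0], [1] or the zero of [g], according to the signs of [g]
   at the endpoints. *)
Lemma unimodal_of_decreasing_derivative (h g : R -> R) (k : R) :
  0 < k ->
  {within `[0, 1], continuous h} -> {within `[0, 1], continuous g} ->
  (forall u : R, u \in `]0, 1[ -> is_derive u (1 : R) h (k * g u)) ->
  {in `[0, 1] &, {homo g : x y /~ x < y}} ->
  exists m, [/\ m \in `[0, 1],
    {in `[0, m] &, {homo h : x y / x < y}},
    {in `[m, 1] &, {homo h : x y /~ x < y}} &
    [/\ g 0 <= 0 -> m = 0, 0 <= g 1 -> m = 1 & g 1 < 0 < g 0 -> g m = 0]].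
Proof.
move=> k0 ch cg dh gd.
have in0 : (0 : R) \in `[0, 1] by rewrite in_itv/= lexx ler01.
have in1 : (1 : R) \in `[0, 1] by rewrite in_itv/= lexx ler01.
have g10 : g 1 < g 0 by apply: gd.
have sub (a b x : R) : a \in `[0, 1] -> b \in `[0, 1] -> x \in `]a, b[ ->
    x \in `]0, 1[.
  rewrite !in_itv/= => /andP[a0 _] /andP[_ b1] /andP[ax xb].
  by rewrite (le_lt_trans a0)// (lt_le_trans xb).
have subc (a b : R) : a \in `[0, 1] -> b \in `[0, 1] -> `[a, b] `<=` `[0, 1].
  move=> + + x /=; rewrite !in_itv/= => /andP[a0 _] /andP[_ b1] /andP[ax xb].
  by rewrite (le_trans a0)//= (le_trans xb).
(* As [g] is strictly decreasing, [0 <= g b] forces [g > 0] to the left of [b]; symmetrically,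
   [g a <= 0] forces [g < 0] to the right of [a]. *)
have incr (a b : R) : a \in `[0, 1] -> b \in `[0, 1] -> 0 <= g b ->
    {in `[a, b] &, {homo h : x y / x < y}}.
  move=> a01 b01 gb; apply: gtr0_derive1_lt_cc => [x xab|x xab|].
  - by have [] := dh _ (sub _ _ _ a01 b01 xab).
  - have x01 := sub _ _ _ a01 b01 xab.
    rewrite derive1E; have /@derive_val -> := dh _ x01.
    rewrite mulr_gt0// (le_lt_trans gb)// gd//.
      exact: subset_itv_oo_cc.
    by move: xab; rewrite in_itv/= => /andP[].
  - exact: continuous_subspaceW (subc _ _ a01 b01) ch.
have decr (a b : R) : a \in `[0, 1] -> b \in `[0, 1] -> g a <= 0 ->
    {in `[a, b] &, {homo h : x y /~ x < y}}.
  move=> a01 b01 ga; apply: ltr0_derive1_lt_cc => [x xab|x xab|].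
  - by have [] := dh _ (sub _ _ _ a01 b01 xab).
  - have x01 := sub _ _ _ a01 b01 xab.
    rewrite derive1E; have /@derive_val -> := dh _ x01.
    rewrite pmulr_rlt0// (lt_le_trans _ ga)// gd//.
      exact: subset_itv_oo_cc.
    by move: xab; rewrite in_itv/= => /andP[].
  - exact: continuous_subspaceW (subc _ _ a01 b01) ch.
(* When the peak is an endpoint, one of the two monotonicity claims concerns a single point and is
   vacuous. *)
have itv1 (a : R) : {in `[a, a] &, forall x y, x < y -> False}.
  move=> x y; rewrite !in_itv/= => /andP[ax _] /andP[_ ya] xy.
  by have := lt_le_trans xy (le_trans ya ax); rewrite ltxx.
have [g0|g0] := leP (g 0) 0.
  exists 0; split=> //.
  - by move=> x y x0 y0 /(itv1 _ _ _ x0 y0).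
  - exact: decr.
  - have g1 : g 1 < 0 by exact: lt_le_trans g0.
    by split=> // [|/andP[]//]; rewrite leNgt g1.
have [g1|g1] := leP 0 (g 1).
  exists 1; split=> //; first exact: incr.
  by move=> y x y0 x0 /(itv1 _ _ _ x0 y0).
(* What remains is [g 1 < 0 < g 0]: the intermediate value theorem supplies the peak as a zero of
   [g]. *)
have g10v : Num.min (g 0) (g 1) <= 0 <= Num.max (g 0) (g 1).
  by rewrite ge_min le_max (ltW g0) (ltW g1) orbT.
have [m m01 gm] := IVT ler01 cg g10v.
by exists m; split=> //; [apply: incr; rewrite ?gm|apply: decr; rewrite ?gm].
Qed.

Lemma unimodal_lt (h : R -> R) (m u : R) :
  m \in `[0, 1] ->
  {in `[0, m] &, {homo h : x y / x < y}} ->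
  {in `[m, 1] &, {homo h : x y /~ x < y}} ->
  u \in `[0, 1] -> u != m -> h u < h m.
Proof.
rewrite !in_itv/= => /andP[m0 m1] incr decr /andP[u0 u1] um.
have [um'|mu|/eqP] := ltgtP u m; last by rewrite (negPf um).
  by apply: incr; rewrite ?in_itv/= ?lexx ?m0 ?u0 ?(ltW um').
by apply: decr; rewrite ?in_itv/= ?lexx ?m1 ?u1 ?(ltW mu).
Qed.

(** For [a < m], a step [1/(n+1)] shorter than [m - a] stays on the increasing side; for [m <= a],
    every step goes down. Quantifying over [n] alone makes [a < m] a countable union of conditions
    when [h] and [m] depend on a parameter. *)
Lemma unimodal_peak_gt (h : R -> R) (m a : R) :
  m \in `[0, 1] -> a \in `[0, 1] ->
  {in `[0, m] &, {homo h : x y / x < y}} ->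
  {in `[m, 1] &, {homo h : x y /~ x < y}} ->
  a < m <->
  exists n : nat, a + n.+1%:R^-1 <= 1 /\ h a < h (a + n.+1%:R^-1).
Proof.
rewrite !in_itv/= => /andP[m0 m1] /andP[a0 a1] incr decr.
split=> [am|[n [n1 han]]].
  have [n nam] : exists n : nat, n.+1%:R^-1 < m - a.
    have /cvgr_lt/(_ (m - a)) := @cvg_harmonic R.
    by rewrite subr_gt0 => /(_ am) [n _ /(_ n (leqnn _))]; exists n.
  have n0 : 0 < n.+1%:R^-1 :> R by rewrite invr_gt0.
  exists n; move: n.+1%:R^-1 nam n0 => e ea e0; split; first lra.
  by apply: incr; rewrite ?in_itv/=; try (apply/andP; split); lra.
have n0 : 0 < n.+1%:R^-1 :> R by rewrite invr_gt0.
rewrite ltNge; apply/negP => ma; move: n.+1%:R^-1 n0 n1 han => e e0 e1 han.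
suff : h (a + e) < h a by move=> /(lt_trans han); rewrite ltxx.
by apply: decr; rewrite ?in_itv/=; try (apply/andP; split); lra.
Qed.

End unimodal.

(** * The law of the claim size: integrals against [distr_fun Z] as expectations *)

Section claim_distribution.
Context {d} {Omega : measurableType d} {R : realType}.
Context {P : probability Omega R} (Z : {RV P >-> R}).

(* The Lebesgue-Stieltjes measure lives on [measurableTypeR R], whose display
   differs from the canonical one of [R]. *)
Let Z' : Omega -> measurableTypeR R := Z.

#[local] HB.instance Definition _ :=
  @isMeasurableFun.Build _ _ _ _ Z' (@measurable_funPT _ _ _ _ Z).

Lemma lebesgue_stieltjes_distr_fun (A : set (measurableTypeR R)) :
  measurable A ->
  lebesgue_stieltjes_measure (distr_fun Z) A = distribution P Z' A.
Proof. exact: (@lebesgue_stieltjes_cdf_id R (distribution P Z') A). Qed.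

Variable D : \bar R.

Lemma measurable_claim_range :
  @measurable _ (measurableTypeR R) (claim_range D).
Proof.
have -> : claim_range D = `]0, +oo[ `&` (EFin @^-1` `]-oo, D]).
  by apply/seteqP; split=> z /=; rewrite !in_itv/= andbT => -[].
apply: measurableI; first exact: measurable_itv.
rewrite -[X in measurable X]setTI; apply: EFin_measurable => //.
exact: emeasurable_itv.
Qed.

Hypothesis Z_gt0 : {ae P, forall w, 0 < Z w}.
Hypothesis Z_range : forall z : R, (D <= z%:E)%E -> distr_fun Z z = 1.

(** For real [D], [P(Z <= D)] is the value of the distribution function at [D], hence 1; for
    [D = +oo] the upper bound is no constraint. *)
Lemma ae_claim_range : {ae P, forall w, claim_range D (Z w)}.
Proof.
have : {ae P, forall w, ((Z w)%:E <= D)%E}.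
  have ZD := Z_range; case: D ZD => [z| |] ZD.
  - have PZ : P (Z @^-1` `]-oo, z]) = 1%E.
      rewrite -[LHS]fineK; first exact/(congr1 EFin)/ZD.
      by rewrite fin_num_measure//; exact: measurable_funPTI.
    exists (~` (Z @^-1` `]-oo, z])); split.
    + by apply: measurableC; exact: measurable_funPTI.
    + by rewrite probability_setC ?PZ ?subee//; exact: measurable_funPTI.
    + by move=> w /=; rewrite lee_fin in_itv/=.
  - by apply: aeW => w; rewrite leey.
  (* With [D = -oo] the distribution function would be constantly 1, against its limit 0 at minus
     infinity. *)
  - have F1 z : distr_fun Z z = 1 by apply: ZD; rewrite leNye.
    have /fine_cvg := cvg_cdfNy0 Z.
    have -> : fine \o cdf Z = cst 1 by apply/funext => z; exact: F1.
    move=> /(cvg_unique (@Rhausdorff R) (@cvg_cst _ _ _ _ _))/eqP.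
    by rewrite oner_eq0.
by move=> ZleD; near=> w; split; near: w.
Unshelve. all: by end_near.
Qed.

(** After pushing forward along [Z], restricting to the claim range changes the integrand only on a
    null event. The sign of [f] is prescribed on positive reals only, because [z * expR (s * z)] is
    negative for [z < 0]. *)
Lemma expectation_claim_range (f : R -> R) :
  measurable_fun setT f -> (forall z, 0 < z -> 0 <= f z) ->
  'E_P[(fun w => f (Z w))]%E =
  (\int[lebesgue_stieltjes_measure (distr_fun Z)]_(z in claim_range D)
     (f z)%:E)%E.
Proof.
move=> mf f0; have mD := measurable_claim_range.
rewrite (eq_measure_integral (distribution P Z')); last first.
  by move=> A mA _; exact: lebesgue_stieltjes_distr_fun.
rewrite ge0_integral_pushforward//; last 2 first.
- exact/measurable_EFinP/measurable_funTS.
- by move=> z /set_mem[z0 _]; rewrite lee_fin f0.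
rewrite unlock [RHS]integral_mkcond.
have mE : measurable_fun setT (fun w => (f (Z w))%:E).
  by apply/measurable_EFinP; exact: measurableT_comp.
apply: ae_eq_integral => //.
  apply/(measurable_restrictT _ _).1 => //.
    exact: measurable_funPTI.
  exact: measurable_funTS.
move: ae_claim_range; apply: filterS => w Dw _.
by rewrite patchE mem_set.
Qed.

Lemma integrable_claim_range (f : R -> R) :
  measurable_fun setT f -> (forall z, 0 < z -> 0 <= f z) ->
  'E_P[(fun w => f (Z w))]%E \is a fin_num ->
  (lebesgue_stieltjes_measure (distr_fun Z)).-integrable (claim_range D)
    (EFin \o f).
Proof.
move=> mf f0 Ef; apply/integrableP; split.
  exact/measurable_EFinP/measurable_funTS.
under eq_integral => z /set_mem[z0 _] do rewrite /= ger0_norm ?f0//.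
by rewrite -expectation_claim_range// ltey_eq Ef.
Qed.

End claim_distribution.

(** * The one-dimensional optimization problem at a fixed time and state *)

Section optimum.
Context {R : realType} (mu : {measure set (measurableTypeR R) -> \bar R}).
Variables (B : set R) (s0 : R).
Hypothesis mB : @measurable _ (measurableTypeR R) B.
Hypothesis B_gt0 : forall z, B z -> 0 < z.
Hypothesis intB : forall k, (k <= 2)%N ->
  mu.-integrable B (fun z => (z ^+ k * expR (s0 * z))%:E).

Let M := expmoment mu B.

(** The Lipschitz constant of [M k] is the moment of order [k + 1], and moments are assumed finite
    up to order 2; hence [k <= 1]. *)
Lemma within_continuous_expmoment k : (k <= 1)%N ->
  {within [set s | s <= s0], continuous (M k)}.
Proof.
move=> k1; apply/subspace_continuousP => x /= xs0.
apply/cvgrPdist_lt => e e0; rewrite near_withinE.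
have C0 : 0 <= M k.+1 s0.
  apply: Rintegral_ge0 => z /B_gt0/ltW z0.
  by rewrite mulr_ge0 ?exprn_ge0 ?expR_ge0.
(* Adding 1 keeps the denominator positive even if the Lipschitz constant vanishes. *)
have d0 : 0 < e / (M k.+1 s0 + 1) by rewrite divr_gt0// ltr_wpDl.
near=> y => ys0.
have xy : `|x - y| < e / (M k.+1 s0 + 1).
  by near: y; exact: nbhsx_ballx.
apply: (@le_lt_trans _ _ (M k.+1 s0 * `|x - y|)).
  apply: (expmoment_lipschitz mB B_gt0 ys0 xs0); apply: intB => //.
  exact: leqW.
apply: (@le_lt_trans _ _ ((M k.+1 s0 + 1) * `|x - y|)).
  by rewrite ler_wpM2r// lerDl.
by rewrite mulrC -ltr_pdivlMr// ltr_wpDl.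
Unshelve. all: by end_near. Qed.

(** Truncating at [s0] gives a function that is nondecreasing on the whole line, hence measurable;
    beyond [s0] the moment may be infinite and [M 0] would drop to 0. *)
Lemma measurable_expmoment0 : measurable_fun setT (fun s : R => M 0 (Num.min s s0)).
Proof.
apply: nondecreasing_measurable => // s t st.
apply: (le_expmoment mB B_gt0 _ _ (intB _)) => //.
  by rewrite le_min !ge_min st lexx orbT.
by rewrite ge_min lexx orbT.
Qed.

Variable a : R.
Hypothesis a_gt0 : 0 < a.
Hypothesis as0 : a <= s0.

Lemma retained_le (u : R) : 0 <= u -> a * (1 - u) <= s0.
Proof. by move=> u0; apply: le_trans as0; rewrite ger_pMr// gerBl. Qed.

Lemma is_derive_retained k (u : R) : (k <= 1)%N -> 0 < u ->
  is_derive u (1 : R) (fun v => M k (a * (1 - v))) (- a * M k.+1 (a * (1 - u))).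
Proof.
move=> k1 u0.
have da : is_derive u (1 : R) (fun v => a * (1 - v)) (- a).
  have := is_deriveZ a (is_deriveB (is_derive_cst (1 : R) u 1) (is_derive_id u 1)).
  by rewrite sub0r [_ *: _]mulrN mulr1.
have dM : is_derive (a * (1 - u)) (1 : R) (M k) (M k.+1 (a * (1 - u))).
  apply: is_derive_expmoment => //.
  (* Here [0 < u] gives [a * (1 - u) < s0] strictly, even when [a = s0]. *)
  - by apply: lt_le_trans as0; rewrite gtr_pMr// gtrBl.
  - by apply: intB; exact: leqW.
  - exact: intB.
have : is_derive u (1 : R) (M k \o (fun v => a * (1 - v)))
  (M k.+1 (a * (1 - u)) * - a) by exact: is_derive1_comp.
by rewrite [X in is_derive _ _ _ X]mulrC.
Qed.

Lemma within_continuous_retained k : (k <= 1)%N ->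
  {within `[0, 1], continuous (fun v => M k (a * (1 - v)))}.
Proof.
move=> k1.
apply: (within_continuous_comp (within_continuous_expmoment k1)) => [x|x /=].
  by apply: cvgM; [exact: cvg_cst|apply: cvgB; [exact: cvg_cst|exact: cvg_id]].
by rewrite in_itv/= => /andP[/retained_le].
Qed.

(* The strict bound on the second derivative says that the marginal value [g]
   of reinsurance is strictly decreasing, so that the objective [h] is strictly
   concave. *)
Lemma reinsurance_unimodal (q0 : R -> R) (lam c : R) :
  let dq0 := derive_on `[0, 1] q0 in
  let h u := - a * q0 u + lam * (c - M 0 (a * (1 - u))) in
  let g u := lam * M 1 (a * (1 - u)) - dq0 u in
  {within `[0, 1], continuous q0} ->
  {within `[0, 1], continuous dq0} ->
  (forall u, u \in `]0, 1[ -> derivable_on `[0, 1] q0 u) ->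
  (forall u, u \in `]0, 1[ -> derivable_on `[0, 1] dq0 u) ->
  (forall u, u \in `]0, 1[ ->
    - derive_on `[0, 1] dq0 u < a * lam * M 2 (a * (1 - u))) ->
  {in `[0, 1] &, {homo g : x y /~ x < y}} /\
  exists m, [/\ m \in `[0, 1],
    {in `[0, m] &, {homo h : x y / x < y}},
    {in `[m, 1] &, {homo h : x y /~ x < y}} &
    [/\ g 0 <= 0 -> m = 0, 0 <= g 1 -> m = 1 & g 1 < 0 < g 0 -> g m = 0]].
Proof.
move=> dq0 h g cq cdq dq d2q bnd.
have cg : {within `[0, 1], continuous g}.
  move=> x; apply: cvgB; last exact: cdq.
  by apply: cvgM; [exact: cvg_cst|exact: within_continuous_retained].
have ch : {within `[0, 1], continuous h}.
  move=> x; apply: cvgD; first by apply: cvgM; [exact: cvg_cst|exact: cq].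
  apply: cvgM; first exact: cvg_cst.
  by apply: cvgB; [exact: cvg_cst|exact: within_continuous_retained].
have dg (u : R) : u \in `]0, 1[ -> is_derive u (1 : R) g
    (lam * (- a * M 2 (a * (1 - u))) - derive_on `[0, 1] dq0 u).
  move=> u01; have u0 : 0 < u by move: u01; rewrite in_itv/= => /andP[].
  have h1 := is_deriveZ lam (is_derive_retained (leqnn 1) u0).
  exact: (is_deriveB h1 (derivable_on_interior u01 (d2q _ u01))).
(* In the moment term the two minus signs cancel, so the factor [a] comes out of the whole
   derivative. *)
have dh (u : R) : u \in `]0, 1[ -> is_derive u (1 : R) h (a * g u).
  move=> u01; have u0 : 0 < u by move: u01; rewrite in_itv/= => /andP[].
  have h1 := is_deriveZ (- a) (derivable_on_interior u01 (dq _ u01)).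
  have h2 := is_deriveZ lam (is_deriveB (is_derive_cst c u (1 : R))
    (is_derive_retained (leq0n 1) u0)).
  apply: (is_derive_eq (is_deriveD h1 h2)).
  by rewrite /g /dq0 /GRing.scale/=; ring.
have gd : {in `[0, 1] &, {homo g : x y /~ x < y}}.
  apply: ltr0_derive1_lt_cc => // u u01; first by have [] := dg u u01.
  rewrite derive1E; have /@derive_val -> := dg u u01.
  by have := bnd u u01; lra.
by split=> //; exact: (unimodal_of_decreasing_derivative a_gt0 ch cg dh gd).
Qed.

End optimum.

(** * Measurability of the peak in the parameters *)

Lemma measurable_fun_peak {R : realType} {d} {X : measurableType d} (A : set X)
    (H : X -> R -> R) (m : X -> R) :
  measurable A ->
  (forall u, u \in `[0, 1] -> measurable_fun A (H^~ u)) ->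
  (forall x, A x -> [/\ m x \in `[0, 1],
    {in `[0, m x] &, {homo H x : u v / u < v}} &
    {in `[m x, 1] &, {homo H x : u v /~ u < v}}]) ->
  measurable_fun A m.
Proof.
move=> mA mH Hm.
apply: (measurability _ (RGenOInfty.measurableE R)) => _ [_ [a ->] <-].
(* For a level [a] outside [[0, 1]] the set where [m > a] is everything or empty; only levels inside
   call for the comparison of values of [H]. *)
have [a0|a0] := ltP a 0.
  rewrite (_ : _ `&` _ = A)//; apply/seteqP; split=> [x []//|x Ax].
  split=> //; have [+ _ _] := Hm x Ax.
  by rewrite /= !in_itv/= andbT => /andP[/(lt_le_trans a0)].
have [a1|a1] := ltP 1 a.
  rewrite (_ : _ `&` _ = set0)//; apply/seteqP; split=> [x [Ax]|//].
  have [+ _ _] := Hm x Ax; rewrite /= !in_itv/= andbT => /andP[_ m1].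
  by move=> /(lt_trans a1)/(le_lt_trans m1); rewrite ltxx.
have a01 : a \in `[0, 1] by rewrite in_itv/= a0.
have -> : A `&` m @^-1` `]a, +oo[ = \bigcup_n
    (if a + n.+1%:R^-1 <= 1 then
       A `&` [set x | H x a < H x (a + n.+1%:R^-1)] else set0).
  apply/seteqP; split=> [x [Ax]|x [n _]].
    have [m01 incr decr] := Hm x Ax; rewrite /= in_itv/= andbT.
    move/(unimodal_peak_gt m01 a01 incr decr) => [n [n1 han]].
    by exists n => //; rewrite n1.
  case: ifPn => // n1 [Ax han]; split => //.
  have [m01 incr decr] := Hm x Ax; rewrite /= in_itv/= andbT.
  by apply/(unimodal_peak_gt m01 a01 incr decr); exists n.
apply: bigcup_measurable => n _; case: ifPn => // n1.
have an01 : a + n.+1%:R^-1 \in `[0, 1] by rewrite in_itv/= n1 addr_ge0.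
have := measurable_fun_ltr (mH _ a01) (mH _ an01).
by move=> /(_ mA [set true]); rewrite /preimage/=; exact.
Qed.

(** * The optimal reinsurance strategy *)

Theorem proposition4p1
  (d : measure_display) (Omega : measurableType d) (R : realType)
  (P : probability Omega R) (Z : {RV P >-> R})
  (T r eta : R) (D : \bar R)
  (lambda c : R -> R -> R) (q : R -> R -> R -> R)
  (T_gt0 : 0 < T) (r_gt0 : 0 < r) (eta_gt0 : 0 < eta) (D_gt0 : (0 < D)%E)
  (lambda_meas : measurable_fun (time_space T) (fun p => lambda p.1 p.2))
  (lambda_gt0 : forall t y, t \in `[0, T] -> 0 < lambda t y)
  (c_meas : measurable_fun (time_space T) (fun p => c p.1 p.2))
  (c_gt0 : forall t y, t \in `[0, T] -> 0 < c t y)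
  (Z_gt0 : {ae P, forall w, 0 < Z w})
  (Z_range : forall z : R, (D <= z%:E)%E -> distr_fun Z z = 1)
  (Z_exp : ('E_P[(fun w => expR (eta * Z w * expR (r * T)))%R]
            \is a fin_num)%E)
  (Z_exp1 : ('E_P[(fun w => Z w * expR (eta * Z w * expR (r * T)))%R]
             \is a fin_num)%E)
  (Z_exp2 : ('E_P[(fun w => Z w ^+ 2 * expR (eta * Z w * expR (r * T)))%R]
             \is a fin_num)%E)
  (q_cont : {within (time_space T `*` `[0, 1]),
               continuous (fun p : R * R * R => q p.1.1 p.1.2 p.2)})
  (q_ge0 : forall t y u, t \in `[0, T] -> u \in `[0, 1] -> 0 <= q t y u)
  (q_derivable : forall t y u, t \in `[0, T] -> u \in `[0, 1] ->
     derivable_on `[0, 1] (q t y) u)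
  (dq_cont : forall t y, t \in `[0, T] ->
     {within `[0, 1], continuous (dq q t y)})
  (dq_derivable : forall t y u, t \in `[0, T] -> u \in `[0, 1] ->
     derivable_on `[0, 1] (dq q t y) u)
  (d2q_cont : forall t y, t \in `[0, T] ->
     {within `[0, 1], continuous (d2q q t y)})
  (q_at0 : forall t y, t \in `[0, T] -> q t y 0 = 0)
  (dq_ge0 : forall t y u, t \in `[0, T] -> u \in `[0, 1] -> 0 <= dq q t y u)
  (q_at1 : forall t y, t \in `[0, T] -> c t y < q t y 1)
  (d2q_bound : forall t y u, t \in `[0, T] -> u \in `]0, 1[ ->
     ((- d2q q t y u)%:E <
      (eta * expR (r * (T - t)) * lambda t y)%:E *
      'E_P[(fun w => Z w ^+ 2 *
              expR (eta * (1 - u) * Z w * expR (r * (T - t))))%R])%E) :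
  exists uhat : R -> R -> R,
    (forall t y, Ahat Z T r eta lambda q (t, y) ->
       unique (solves_foc Z T r eta D lambda q t y) (uhat t y)) /\
  exists ustar : R -> R -> R,
    [/\ measurable_fun (time_space T) (fun p => ustar p.1 p.2),
        forall t y, t \in `[0, T] ->
          solves_sup Z T r eta D lambda q t y (ustar t y),
        forall v : R -> R -> R,
          measurable_fun (time_space T) (fun p => v p.1 p.2) ->
          (forall t y, t \in `[0, T] ->
             solves_sup Z T r eta D lambda q t y (v t y)) ->
          forall t y, t \in `[0, T] -> v t y = ustar t y &
        forall t y, t \in `[0, T] ->
          [/\ A0 Z T r eta lambda q (t, y) -> ustar t y = 0,
              Ahat Z T r eta lambda q (t, y) -> ustar t y = uhat t y &
              A1 Z T lambda q (t, y) -> ustar t y = 1]].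
Proof.
pose nu := lebesgue_stieltjes_measure (distr_fun Z).
pose B := claim_range D.
(* The largest value of [eta (1 - u) e^(r(T-t))], attained at [t = 0] and [u = 0]; it is the
   exponent of the moment hypotheses. *)
pose s0 := eta * expR (r * T).
pose M := expmoment nu B.
have mB := measurable_claim_range D.
have B0 z : B z -> 0 < z by case.
have mpe k s := @measurable_powexp R setT k s.
have pe0 k s (z : R) : 0 < z -> 0 <= z ^+ k * expR (s * z).
  by move=> /ltW z0; rewrite mulr_ge0 ?exprn_ge0 ?expR_ge0.
have intB k : (k <= 2)%N ->
    nu.-integrable B (fun z => (z ^+ k * expR (s0 * z))%:E).
  move=> k2; apply: (integrable_claim_range Z_gt0 Z_range (mpe _ _) (pe0 _ _)).
  have eZ w : eta * Z w * expR (r * T) = s0 * Z w by rewrite mulrAC.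
  case: k k2 => [|[|[|//]]] _; [move: Z_exp|move: Z_exp1|move: Z_exp2];
    congr (expectation _ _ \is a fin_num); apply/funext => w;
    by rewrite eZ ?mul1r.
have EM k (s : R) : (k <= 2)%N -> s <= s0 ->
    ('E_P[(fun w => Z w ^+ k * expR (s * Z w))%R] = (M k s)%:E)%E.
  move=> k2 ss0.
  rewrite (expectation_claim_range Z_gt0 Z_range (mpe k s) (pe0 k s)).
  by rewrite (expmomentE mB B0 ss0 (intB _ k2)).
pose a (t : R) := eta * expR (r * (T - t)).
have a_gt0 (t : R) : 0 < a t by rewrite mulr_gt0 ?expR_gt0.
have as0 (t : R) : t \in `[0, T] -> a t <= s0.
  rewrite in_itv/= => /andP[t0 _]; rewrite ler_wpM2l ?(ltW eta_gt0)//.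
  by rewrite ler_expR ler_wpM2l ?(ltW r_gt0)// gerBl.
have au (t u : R) : t \in `[0, T] -> u \in `[0, 1] -> a t * (1 - u) <= s0.
  by rewrite [u \in _]in_itv/= => /as0 ats /andP[u0 _]; exact: retained_le.
have in0 : (0 : R) \in `[0, 1] by rewrite in_itv/= lexx ler01.
have in1 : (1 : R) \in `[0, 1] by rewrite in_itv/= lexx ler01.
have s00 : 0 <= s0 by rewrite mulr_ge0 ?expR_ge0 ?(ltW eta_gt0).
pose H (t y u : R) := - a t * q t y u + lambda t y * (M 0 0 - M 0 (a t * (1 - u))).
pose g (t y u : R) := lambda t y * M 1 (a t * (1 - u)) - dq q t y u.
(* The extended-real objective is finite for [t] in [[0, T]] and [u] in [[0, 1]], so it can be
   compared through the real function [H]. *)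
have PsiE (t y u : R) : t \in `[0, T] -> u \in `[0, 1] ->
    Psi Z T r eta D lambda q t y u = (H t y u)%:E.
  move=> t01 u01; rewrite /Psi /H EFinD !mulNr; congr (_ + _)%E.
  rewrite EFinM; congr (_ * _)%E.
  under eq_integral do rewrite EFinB.
  (* The constant 1 is the integrand of order 0 at exponent 0, whence the term [M 0 0] in [H]. *)
  have E0 (z : R) : (1%:E : \bar R) = (z ^+ 0 * expR (0 * z))%:E.
    by rewrite mul0r expR0 mulr1.
  have E1 (z : R) : (expR (eta * (1 - u) * z * expR (r * (T - t))))%:E =
      (z ^+ 0 * expR (a t * (1 - u) * z))%:E.
    by rewrite expr0 mul1r /a; congr (expR _)%:E; ring.
  under eq_integral => z _ do rewrite (E0 z) E1.
  rewrite integralB_EFin//.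
  - by rewrite !(expmomentE mB B0 _ (intB 0 _))//; exact: au.
  - exact: (integrable_powexp mB B0 s00 (intB 0 _)).
  - exact: (integrable_powexp mB B0 (au _ _ t01 u01) (intB 0 _)).
have focE (t y u : R) : t \in `[0, T] -> u \in `[0, 1] ->
    solves_foc Z T r eta D lambda q t y u <-> g t y u = 0.
  move=> t01 u01; rewrite /solves_foc.
  under eq_integral => z _.
    rewrite (_ : z * _ = z ^+ 1 * expR (a t * (1 - u) * z)); last first.
      by rewrite expr1 /a; congr (_ * expR _); ring.
    over.
  rewrite (expmomentE mB B0 (au _ _ t01 u01) (intB 1 _))// -EFinM /g.
  split=> [[_ [->]]|/subr0_eq ->]; last by [].
  by rewrite subrr.
(* The exponents [a t * (1 - 0)] and [a t * (1 - 1)] are left unsimplified so that the two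
   expectations match [g] at the endpoints. *)
have EA0 (t : R) : t \in `[0, T] ->
    ('E_P[(fun w => Z w * expR (eta * Z w * expR (r * (T - t))))%R] =
      (M 1 (a t * (1 - 0)))%:E)%E.
  move=> t01; rewrite -EM//; last exact: au.
  by congr expectation; apply/funext => w; congr (_ * expR _); rewrite /a; ring.
have EA1 (t : R) : t \in `[0, T] -> ('E_P[Z] = (M 1 (a t * (1 - 1)))%:E)%E.
  move=> t01; rewrite -EM//; last exact: au.
  congr expectation; apply/funext => w.
  by rewrite subrr mulr0 mul0r expR0 mulr1.
have cq (t y : R) : t \in `[0, T] -> {within `[0, 1], continuous (q t y)}.
  move=> t01; pose i u : R * R * R := (t, y, u).
  apply: (within_continuous_comp (g := i) q_cont) => [x|x x01].
    apply: (@cvg_pair _ _ _ _ (nbhs (t, y)) (nbhs x)).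
      exact: cvg_cst.
    exact: cvg_id.
  by split.
have mts : measurable (time_space T : set (R * R)) by apply: measurableX.
have mH u : u \in `[0, 1] ->
    measurable_fun (time_space T) (fun p => H p.1 p.2 u).
  move=> u01.
  have ma : measurable_fun (time_space T) (fun p : R * R => a p.1).
    apply: (@measurableT_comp _ _ _ _ _ _ a); last first.
      by apply: measurable_funTS; exact: measurable_fst.
    apply: measurable_funM => //; apply: measurableT_comp => //.
    by apply: measurable_funM => //; exact: measurable_funB.
  apply: measurable_funD.
    apply: measurable_funM; first exact: measurable_funN.
    apply: continuous_within_measurable_prod => //.
    pose i (p : R * R) : R * R * R := (p, u).
    apply: (within_continuous_comp (g := i) q_cont) => [x|x [x1 x2]].
      apply: (@cvg_pair _ _ _ _ (nbhs x) (nbhs u)); first exact: cvg_id.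
      exact: cvg_cst.
    by split.
  apply: measurable_funM => //; apply: measurable_funB => //.
  (* On [time_space T] the exponent is at most [s0], so the truncation changes nothing there. *)
  apply: (eq_measurable_fun
    (fun p : R * R => M 0 (Num.min (a p.1 * (1 - u)) s0))).
    by move=> p /set_mem[/= t01 _]; rewrite min_l//; exact: au.
  apply: (measurableT_comp (measurable_expmoment0 mB B0 intB)).
  exact: measurable_funM.
have opt (t y : R) : t \in `[0, T] ->
  {in `[0, 1] &, {homo g t y : u v /~ u < v}} /\
  exists m, [/\ m \in `[0, 1],
    {in `[0, m] &, {homo H t y : u v / u < v}},
    {in `[m, 1] &, {homo H t y : u v /~ u < v}} &
    [/\ g t y 0 <= 0 -> m = 0, 0 <= g t y 1 -> m = 1 &
        g t y 1 < 0 < g t y 0 -> g t y m = 0]].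
  move=> t01; apply: (reinsurance_unimodal mB B0 intB (a_gt0 t) (as0 t t01)).
  - exact: cq.
  - exact: dq_cont.
  - by move=> u /subset_itv_oo_cc; exact: q_derivable.
  - by move=> u /subset_itv_oo_cc; exact: dq_derivable.
  - move=> u u01; rewrite -lte_fin EFinM; have := d2q_bound t y u t01 u01.
    rewrite (_ : (fun w => _) =
        (fun w => Z w ^+ 2 * expR (a t * (1 - u) * Z w))).
      by rewrite EM//; apply: au => //; exact: subset_itv_oo_cc.
    by apply/funext => w; rewrite /a; congr (_ * expR _); ring.
(* A peak is chosen at every point of the plane, with default 0 for [t] outside [[0, T]]; the
   monotonicity of [g] is carried along for the uniqueness of [uhat]. *)
have {opt} /choice[f Hf] (p : R * R) : exists m, p.1 \in `[0, T] ->
    [/\ m \in `[0, 1],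
    {in `[0, m] &, {homo H p.1 p.2 : u v / u < v}},
    {in `[m, 1] &, {homo H p.1 p.2 : u v /~ u < v}} &
    [/\ {in `[0, 1] &, {homo g p.1 p.2 : u v /~ u < v}},
      g p.1 p.2 0 <= 0 -> m = 0, 0 <= g p.1 p.2 1 -> m = 1 &
      g p.1 p.2 1 < 0 < g p.1 p.2 0 -> g p.1 p.2 m = 0]].
  have [t01|] := boolP (p.1 \in `[0, T]); last by exists 0.
  have [gd [m [m01 incr decr [m0 m1 gm]]]] := opt p.1 p.2 t01.
  by exists m.
(* Every other point of [[0, 1]] is strictly worse than the peak, so this equivalence contains both
   existence and uniqueness of the maximizer. *)
have Hsup t y (v : R) : t \in `[0, T] ->
    solves_sup Z T r eta D lambda q t y v <-> v = f (t, y).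
  move=> t01; have [/= m01 incr decr _] := Hf (t, y) t01.
  have Hle u : u \in `[0, 1] -> H t y u <= H t y (f (t, y)).
    move=> u01; have [->//|um] := eqVneq u (f (t, y)).
    exact/ltW/(unimodal_lt m01 incr decr u01 um).
  have -> : solves_sup Z T r eta D lambda q t y v <->
      (v \in `[0, 1] /\ H t y v = H t y (f (t, y))).
    rewrite /solves_sup.
    have -> : ereal_sup [set Psi Z T r eta D lambda q t y u | u in `[0, 1]] =
        (H t y (f (t, y)))%:E.
      apply/eqP; rewrite eq_le; apply/andP; split.
        by apply: ge_ereal_sup => _ [u u01 <-]; rewrite PsiE// lee_fin Hle.
      by rewrite -PsiE//; apply: ereal_sup_ubound; exists (f (t, y)).
    split=> -[v01]; first by rewrite PsiE// => -[].
    by move=> Hv; rewrite PsiE// Hv.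
  split=> [[v01 Hv]|->]; last by [].
  apply/eqP; apply/negP => /negP vm.
  by have := unimodal_lt m01 incr decr v01 vm; rewrite Hv ltxx.
(* The regions become sign conditions on [g]: [A0] means [g 0 <= 0], [Ahat] means [g 1 < 0 < g 0],
   and [A1] means [0 <= g 1]. *)
have EB0 t y : t \in `[0, T] -> ((lambda t y)%:E *
   'E_P[(fun w => Z w * expR (eta * Z w * expR (r * (T - t))))%R] =
   (g t y 0 + dq q t y 0)%:E)%E.
  by move=> t01; rewrite EA0// -EFinM subrK.
have EB1 t y : t \in `[0, T] ->
   ('E_P[Z] * (lambda t y)%:E = (g t y 1 + dq q t y 1)%:E)%E.
  by move=> t01; rewrite (EA1 t)// -EFinM subrK mulrC.
have Hhat t y : Ahat Z T r eta lambda q (t, y) ->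
    t \in `[0, T] /\ g t y 1 < 0 < g t y 0.
  move=> [/= [t01 _]]; rewrite EB0// EB1// !lte_fin ltrDr -subr_gt0.
  by rewrite opprD addrC subrK oppr_gt0 => -> ->.
(* The same peak serves as [uhat] and as [ustar]; on [Ahat] it is the zero of [g]. *)
exists (fun t y => f (t, y)); split.
  move=> t y /Hhat[t01 g01]; have [/= m01 _ _ [gd _ _ gm]] := Hf (t, y) t01.
  split; first exact/focE/gm.
  move=> u su; have u01 : u \in `[0, 1] by case: su.
  have gu : g t y u = 0 by exact/focE.
  (* A strictly decreasing [g] cannot vanish at two points. *)
  apply/eqP; rewrite eq_le !leNgt; apply/andP; split; apply/negP => /gd.
    by rewrite gu gm// ltxx => /(_ m01 u01).
  by rewrite gu gm// ltxx => /(_ u01 m01).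
exists (fun t y => f (t, y)); split.
- apply: (measurable_fun_peak mts mH) => -[t y] [/= t01 _].
  by have [] := Hf (t, y) t01.
- by move=> t y t01; apply/Hsup.
- by move=> v _ vsup t y t01; apply/Hsup => //; exact: vsup.
- move=> t y t01; have [/= _ _ _ [_ m0 m1 _]] := Hf (t, y) t01; split=> //.
  + by move=> [_]; rewrite /= EB0// lee_fin gerDr => /m0.
  + by move=> [_]; rewrite /= EB1// lee_fin lerDr => /m1.
Qed.
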